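(* For any $m\in\mathbb{Z}\setminus\{0\}$ and $\xi\in\mathbb{Z}_m\setminus m\mathbb{Z}_m$, the group $\overline{BS}(m,\xi)$ is not finitely presented.
   Context: A marked group on $k$ generators is a pair $(G,S)$ with $S=(s_1,\dots,s_k)\in G^k$ generating $G$, considered up to isomorphisms respecting the markings. $\mathcal{G}_k$ is the set of marked groups on $k$ generators with the ultrametric $d((G_1,S_1),(G_2,S_2))=e^{-\lambda}$, where $\lambda$ is the word length of a shortest element of the free group $\mathbb{F}_k$ that is trivial in one group and not in the other. For $m,n\in\mathbb{Z}\setminus\{0\}$, $BS(m,n)=\langle a,b\mid ab^ma^{-1}=b^n\rangle$, marked by $(a,b)$. The ring of $m$-adic integers is $\mathbb{Z}_m=\varprojlim_h \mathbb{Z}/m^h\mathbb{Z}$ (the zero ring if $|m|=1$). For $\xi\in\mathbb{Z}_m$, $\overline{BS}(m,\xi)=\lim_{n\to\infty}BS(m,\xi_n)$ in $\mathcal{G}_2$, where $(\xi_n)_n$ is any sequence of non-zero rational integers with $|\xi_n|\to\infty$ and $\xi_n\to\xi$ in $\mathbb{Z}_m$ (it is known that this limit exists and does not depend on the choice of $(\xi_n)_n$). *)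

(* Defs.v *)
From HB Require Import structures.
From mathcomp Require Import all_boot all_order all_algebra.
From mathcomp Require Import all_classical all_reals all_analysis.

Set Implicit Arguments.
Unset Strict Implicit.
Unset Printing Implicit Defensive.

Import Order.TTheory GRing.Theory Num.Theory.
Import numFieldNormedType.Exports.

Local Open Scope quotient_scope.

(** * Words and presentations *)

(* The letter [(i, false)] is the generator [x_i]; [(i, true)] is its formal
   inverse.  Words need not be reduced. *)
Definition letter (k : nat) : Type := ('I_k * bool)%type.
Definition word (k : nat) : Type := seq (letter k).

Definition letter_inv k (x : letter k) : letter k := (x.1, ~~ x.2).
Definition word_inv k (w : word k) : word k := rev (map (@letter_inv k) w).

Definition eval_letter (G : groupType) k (s : 'I_k -> G) (x : letter k) : G :=
  if x.2 then (s x.1)^-1%g else s x.1.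
Definition eval_word (G : groupType) k (s : 'I_k -> G) (w : word k) : G :=
  (\prod_(x <- w) eval_letter s x)%g.

(* [pres_eq rel u v]: the words [u] and [v] represent the same element of the
   group generated by the [x_i] subject to the relators in [rel]. *)
Inductive pres_eq k (rel : set (word k)) : word k -> word k -> Prop :=
| pres_refl u : pres_eq rel u u
| pres_sym u v : pres_eq rel u v -> pres_eq rel v u
| pres_trans u v w : pres_eq rel u v -> pres_eq rel v w -> pres_eq rel u w
| pres_cat u u' v v' :
    pres_eq rel u u' -> pres_eq rel v v' -> pres_eq rel (u ++ v) (u' ++ v')
| pres_cancel x : pres_eq rel [:: x; letter_inv x] [::]
| pres_rel r : rel r -> pres_eq rel r [::].

Section PresentedGroup.
Context (k : nat) (rel : set (word k)).

Definition pres_eqb (u v : word k) : bool := `[< pres_eq rel u v >].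

Lemma pres_eqb_refl : reflexive pres_eqb.
Proof. by move=> u; apply/asboolP; exact: pres_refl. Qed.

Lemma pres_eqb_sym : symmetric pres_eqb.
Proof. by move=> u v; apply/asboolP/asboolP; exact: pres_sym. Qed.

Lemma pres_eqb_trans : transitive pres_eqb.
Proof.
by move=> v u w /asboolP uv /asboolP vw; apply/asboolP; exact: pres_trans vw.
Qed.

Canonical pres_equiv : equiv_rel (word k) :=
  EquivRel pres_eqb pres_eqb_refl pres_eqb_sym pres_eqb_trans.

Definition presented : Type := {eq_quot pres_equiv}.
HB.instance Definition _ := Choice.on presented.
HB.instance Definition _ := Quotient.on presented.

Definition pres_class (w : word k) : presented := \pi_presented w.

Lemma pres_classP u v : pres_class u = pres_class v <-> pres_eq rel u v.
Proof.
split=> [/eqmodP /asboolP //|uv].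
by apply/eqmodP; apply/asboolP.
Qed.

Lemma pres_class_repr (g : presented) : pres_class (repr g) = g.
Proof. exact: reprK. Qed.

Lemma pres_eq_repr w : pres_eq rel (repr (pres_class w)) w.
Proof. by apply/pres_classP; rewrite pres_class_repr. Qed.

Lemma letter_invK : involutive (@letter_inv k).
Proof. by case=> i b; rewrite /letter_inv /= negbK. Qed.

Lemma word_invK : involutive (@word_inv k).
Proof.
move=> w; rewrite /word_inv map_rev revK -map_comp -[RHS]map_id.
by apply: eq_map => x /=; rewrite letter_invK.
Qed.

Lemma pres_mulwV w : pres_eq rel (w ++ word_inv w) [::].
Proof.
elim: w => [|x w IH]; first exact: pres_refl.
have -> : (x :: w) ++ word_inv (x :: w)
    = [:: x] ++ (w ++ word_inv w) ++ [:: letter_inv x].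
  by rewrite /word_inv /= rev_cons -cats1 !catA.
apply: pres_trans (pres_cancel rel x).
apply: (@pres_cat _ _ [:: x] [:: x]); first exact: pres_refl.
by apply: (@pres_cat _ _ _ [::] [:: letter_inv x]) => //; exact: pres_refl.
Qed.

Lemma pres_mulVw w : pres_eq rel (word_inv w ++ w) [::].
Proof. by rewrite -{2}(word_invK w); exact: pres_mulwV. Qed.

Lemma pres_inv u v : pres_eq rel u v -> pres_eq rel (word_inv u) (word_inv v).
Proof.
move=> uv; rewrite -[word_inv u]cats0.
have h1 : pres_eq rel (word_inv u ++ [::]) (word_inv u ++ (v ++ word_inv v)).
  by apply: pres_cat; [exact: pres_refl|apply: pres_sym; exact: pres_mulwV].
apply: (pres_trans h1); rewrite catA.
apply: (@pres_cat _ _ _ [::]); last exact: pres_refl.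
apply: pres_trans (pres_mulVw u).
by apply: pres_cat; [exact: pres_refl|exact: pres_sym].
Qed.

Definition pres_one : presented := pres_class [::].
Definition pres_mul (g h : presented) : presented :=
  pres_class (repr g ++ repr h).
Definition pres_invg (g : presented) : presented :=
  pres_class (word_inv (repr g)).

Lemma pres_mul_class u v :
  pres_mul (pres_class u) (pres_class v) = pres_class (u ++ v).
Proof. by apply/pres_classP; apply: pres_cat; exact: pres_eq_repr. Qed.

Lemma pres_inv_class u : pres_invg (pres_class u) = pres_class (word_inv u).
Proof. by apply/pres_classP; apply: pres_inv; exact: pres_eq_repr. Qed.

Lemma pres_mulA : associative pres_mul.
Proof.
move=> x y z; rewrite -(pres_class_repr x) -(pres_class_repr y).
rewrite -(pres_class_repr z).
by rewrite !pres_mul_class catA.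
Qed.

Lemma pres_mul1 : left_id pres_one pres_mul.
Proof. by move=> x; rewrite -(pres_class_repr x) pres_mul_class. Qed.

Lemma pres_mul1r : right_id pres_one pres_mul.
Proof. by move=> x; rewrite -(pres_class_repr x) pres_mul_class cats0. Qed.

Lemma pres_mulV : left_inverse pres_one pres_invg pres_mul.
Proof.
move=> x; rewrite -(pres_class_repr x) pres_inv_class pres_mul_class.
by apply/pres_classP; exact: pres_mulVw.
Qed.

Lemma pres_mulVr : right_inverse pres_one pres_invg pres_mul.
Proof.
move=> x; rewrite -(pres_class_repr x) pres_inv_class pres_mul_class.
by apply/pres_classP; exact: pres_mulwV.
Qed.

HB.instance Definition _ := isGroup.Build presented
  pres_mulA pres_mul1 pres_mul1r pres_mulV pres_mulVr.

Definition pres_gen (i : 'I_k) : presented := pres_class [:: (i, false)].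

Lemma eval_pres_gen w : eval_word pres_gen w = pres_class w.
Proof.
rewrite /eval_word; elim: w => [|x w IH]; first by rewrite big_nil.
rewrite big_cons IH -[x :: w]cat1s -pres_mul_class; congr pres_mul.
case: x => i [] //; rewrite /eval_letter /=.
exact: (pres_inv_class [:: (i, false)]).
Qed.

Lemma pres_gen_generates g : exists w, eval_word pres_gen w = g.
Proof. by exists (repr g); rewrite eval_pres_gen pres_class_repr. Qed.

End PresentedGroup.

(* The presentation may use any finite number of generators, not only those of
   a given marking. *)
Definition finitely_presented (G : groupType) : Prop :=
  exists (k : nat) (rels : seq (word k))
         (f : {multiplicative presented [set r | r \in rels] -> G}),
    bijective f.

(** * Marked groups *)

Record marked_group (k : nat) := MarkedGroup {
  marked_sort :> groupType;
  marking : 'I_k -> marked_sort;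
  marking_generates : forall g, exists w, eval_word marking w = g }.

Definition presented_marked k (rel : set (word k)) : marked_group k :=
  MarkedGroup (@pres_gen_generates k rel).

Definition trivial_in k (G : marked_group k) (w : word k) : bool :=
  eval_word (marking G) w == 1%g.

(* Some word of length [n] is trivial in exactly one of [G], [H].  Triviality
   only depends on the element of the free group represented by the word, so
   the least such [n] is the same as over reduced words only, i.e., it is the
   length of a shortest distinguishing element of the free group. *)
Definition differ_at k (G H : marked_group k) (n : nat) : bool :=
  [exists w : n.-tuple (letter k), trivial_in G w != trivial_in H w].

(* The distance vanishes iff [G] and [H] are isomorphic as marked groups: on
   [marked_group k] it is a pseudometric whose metric quotient is the space of
   marked groups on [k] generators. *)
Definition marked_dist (R : realType) k (G H : marked_group k) : R :=
  if pselect (exists n, differ_at G H n) is left e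
  then expR (- (ex_minn e)%:R)%R else 0%R.

Definition marked_cvg (R : realType) k (G : nat -> marked_group k)
    (L : marked_group k) : Prop :=
  (marked_dist R (G n) L @[n --> \oo] --> (0 : R)%R)%classic.

(** * Baumslag-Solitar groups *)

Definition gen_a : 'I_2 := ord0.
Definition gen_b : 'I_2 := ord_max.

Definition gen_pow k (i : 'I_k) (z : int) : word k :=
  nseq `|z|%N (i, (z < 0)%R).

Definition BS_relator (m n : int) : word 2 :=
  gen_pow gen_a 1 ++ gen_pow gen_b m ++ gen_pow gen_a (-1) ++
    gen_pow gen_b (- n)%R.

Definition BS (m n : int) : marked_group 2 :=
  presented_marked [set BS_relator m n]%classic.

(** * m-adic integers *)

(* The residue of [z] in [Z/m^hZ], given by its representative in
   [0, |m|^h). *)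
Definition madic_red (m : int) (h : nat) (z : int) : int := modz z (m ^+ h)%R.

(* An element of [lim_h Z/m^hZ].  When [m != 0], [madic_coherent] also forces
   [madic_res h] to be a representative in [0, |m|^h); in particular, there is
   only one element if [|m| = 1]. *)
Record madic (m : int) := Madic {
  madic_res : nat -> int;
  madic_coherent : forall h, madic_res h = madic_red m h (madic_res h.+1) }.

Lemma madic_red_redS m h z :
  madic_red m h (madic_red m h.+1 z) = madic_red m h z.
Proof.
rewrite /madic_red [in RHS](divz_eq z (m ^+ h.+1)%R).
by rewrite exprS mulrA modzMDl.
Qed.

Lemma madic_intmul_subproof (m c : int) (x : madic m) (h : nat) :
  madic_red m h (c * madic_res x h)%R =
  madic_red m h (madic_red m h.+1 (c * madic_res x h.+1)%R).
Proof. by rewrite madic_red_redS madic_coherent /madic_red modzMmr. Qed.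

Definition madic_intmul (m c : int) (x : madic m) : madic m :=
  Madic (@madic_intmul_subproof m c x).

Definition madic_dvd (m : int) (x : madic m) : Prop :=
  exists y : madic m, x = madic_intmul m y.

Definition madic_cvg (m : int) (u : nat -> int) (x : madic m) : Prop :=
  forall h, (\forall n \near \oo, madic_red m h (u n) = madic_res x h)%classic.

(* [L] is a limit of [BS(m, u_n)] for some sequence [u] as in the definition of
   the limit group.  Since the limit exists, does not depend on [u] and is
   unique up to isomorphism of marked groups, this singles out one point of the
   space of marked groups on two generators. *)
Definition is_BSbar (R : realType) (m : int) (xi : madic m)
    (L : marked_group 2) : Prop :=
  exists u : nat -> int,
    [/\ forall n, u n != 0%R,
        forall B : nat, (\forall n \near \oo, (B <= `|u n|)%N)%classic,
        madic_cvg u xi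
      & marked_cvg R (fun n => BS m (u n)) L].

(* Main.v *)
(* Put [e_0 = n], [e_(i+1) = n * (e_i div m)], [w_0 = a b^m a^-1] and
   [w_(i+1) = a b^(- r_i) w_i a^-1].  In [BS(m, n)], [w_i = b^(e_i)] as long as
   [r_j = e_j mod m] for all [j < i].  Since [e_i mod m] only depends on [n]
   modulo [m^(i+1)], [xi] determines a sequence [r] for which all the relations
   [[b, w_i] = 1] hold in the limit group.  If the latter were finitely
   presented, [BS(m, u_N)] would be a marked quotient of it for all large [N],
   and would satisfy all these relations.  But [a b^k a^-1] commutes with [b] in
   [BS(m, n)] only if [m] divides [k] (when [|m| < |n|]), so that
   [e_i(u_N) mod m = r_i] for all [i]; when [m] does not divide [n], the sequence
   [e_i(n) mod m] determines [n], so [u_N] would be eventually constant. *)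
Require Import Defs.
From mathcomp Require Import all_boot all_order all_algebra.
From mathcomp Require Import all_classical all_reals all_analysis.
From mathcomp Require Import zify ring.

Set Implicit Arguments.
Unset Strict Implicit.
Unset Printing Implicit Defensive.

Import Order.TTheory GRing.Theory Num.Theory.
Local Open Scope ring_scope.


(** * Arithmetic of the exponents [e_i] *)

Lemma expz_dvd_eq0 (p z : int) :
  (1 < `|p|)%N -> (forall h, (p ^+ h %| z)%Z) -> z = 0.
Proof.
(* The exponent [|z|] suffices, since [|z| < |p|^|z|]. *)
move=> p1 /(_ `|z|%N); rewrite dvdzE abszX => pz.
apply/eqP; rewrite -absz_eq0 -leqn0 leqNgt; apply/negP => z0.
by have := dvdn_leq z0 pz; rewrite leqNgt ltn_expl.
Qed.

Lemma modz_expS_divz (m y z : int) h : m != 0 ->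
  (y = z %[mod m ^+ h.+1])%Z -> ((y %/ m)%Z = (z %/ m)%Z %[mod m ^+ h])%Z.
Proof.
move=> m0 /eqP; rewrite eqz_mod_dvd => /dvdzP[q /eqP].
rewrite subr_eq => /eqP ->.
by rewrite exprSr mulrA divzMDl// modzMDl.
Qed.

(* The sequence [e_i] of the header. *)
Fixpoint BS_exp (m n : int) (i : nat) : int :=
  if i is j.+1 then n * (BS_exp m n j %/ m)%Z else n.

(** Each step of the recursion divides by [m] once, which costs one power of [m] in the modulus. *)
Lemma BS_exp_mod (m n n' : int) i h : m != 0 ->
  (n = n' %[mod m ^+ (h + i)])%Z ->
  (BS_exp m n i = BS_exp m n' i %[mod m ^+ h])%Z.
Proof.
move=> m0; elim: i h => [|i IH] h nn' /=; first by rewrite addn0 in nn'.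
have /(modz_expS_divz m0) e : (BS_exp m n i = BS_exp m n' i %[mod m ^+ h.+1])%Z.
  by apply: IH; rewrite addSnnS.
have {}nn' : (n = n' %[mod m ^+ h])%Z.
  apply/eqP; rewrite eqz_mod_dvd; apply: (@dvdz_trans (m ^+ (h + i.+1))).
    by rewrite dvdz_exp2l// leq_addr.
  by rewrite -eqz_mod_dvd; apply/eqP.
by rewrite -modzMm e nn' modzMm.
Qed.

(** Let [d = gcd(m, n)] and [m = m' d]. By induction on [h], [d m'^h] divides [e_i(n) - e_i(n')] for
    all [i]. As [m] does not divide [n], [|m'| > 1], so the difference at [i = 0] vanishes. *)
Lemma BS_exp_mod_inj (m n n' : int) : m != 0 -> ~~ (m %| n)%Z ->
  (forall i, (BS_exp m n i = BS_exp m n' i %[mod m])%Z) -> n = n'.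
Proof.
move=> m0 mn ee'.
have gg : gcdz m n = gcdz m n' by rewrite -gcdz_modr (ee' 0%N) gcdz_modr.
pose d := gcdz m n.
have d0 : d != 0 by rewrite gcdz_eq0 (negPf m0).
have /dvdzP[m' mE] := dvdz_gcdl m n; rewrite -/d in mE.
have /dvdzP[v nE] := dvdz_gcdr m n; rewrite -/d in nE.
have m'v : coprimez m' v.
  rewrite /coprimez; apply/eqP.
  have : gcdz m' v * `|d|%:Z = 1 * `|d|%:Z.
    by rewrite mulz_gcdl -mE -nE mul1r [RHS]gez0_abs.
  by apply: mulIf; lia.
have dvd_exp k i : (d %| k)%Z -> (d %| BS_exp m k i)%Z.
  by case: i => [|i]//= dk; apply: dvdz_mulr.
have dn : (d %| n)%Z by exact: dvdz_gcdr.
have dn' : (d %| n')%Z by rewrite /d gg; exact: dvdz_gcdr.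
(* From [h] to [h + 1]: writing [e_i = m q_i + r_i] and likewise for [e'],
   [n (e_i - e'_i) = m (e_(i+1) - e'_(i+1)) - (n - n') m q'_i]. *)
have key h i : (d * m' ^+ h %| BS_exp m n i - BS_exp m n' i)%Z.
  elim: h i => [|h IH] i; first by rewrite mulr1 rpredB// dvd_exp.
  have /dvdzP[x xE] := dvd_exp _ i dn.
  have /dvdzP[y yE] := dvd_exp _ i dn'.
  (* Here [n = v d], [e_i = x d] and [e'_i = y d]; the factor [v] is coprime to [m'] and can be
     cancelled. *)
  suff: (m' ^+ h.+1 %| v * (x - y))%Z.
    rewrite Gauss_dvdzr ?coprimezXl// => mxy.
    by rewrite xE yE -mulrBl mulrC dvdz_mul.
  rewrite -(@dvdz_mul2l (d * d)) ?mulf_neq0//.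
  set q := (BS_exp m n i %/ m)%Z; set q' := (BS_exp m n' i %/ m)%Z.
  have qE := divz_eq (BS_exp m n i) m; rewrite -/q in qE.
  have qE' := divz_eq (BS_exp m n' i) m; rewrite -/q' -ee' in qE'.
  have /dvdzP[s sE] := IH i.+1; rewrite /= -/q -/q' in sE.
  have /dvdzP[t tE] := IH 0%N; rewrite /= in tE.
  apply/dvdzP; exists (s - t * q').
  have -> : d * d * (v * (x - y)) = n * (BS_exp m n i - BS_exp m n' i).
    by rewrite xE yE nE; ring.
  rewrite qE qE' exprS.
  transitivity (m * (n * q - n' * q') - (n - n') * (q' * m)); first by ring.
  by rewrite sE tE mE; ring.
apply/eqP; rewrite -subr_eq0; apply/eqP; apply: (@expz_dvd_eq0 m').
  (* If [|m'| <= 1], then [m'] is a unit, and [m = m' d] divides [n = v d]. *)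
  rewrite ltnNge; apply: contra mn => m'1.
  have m'u : (m' %| v)%Z.
    rewrite dvdzE; suff -> : `|m'|%N = 1%N by rewrite dvd1n.
    apply/eqP; rewrite eqn_leq m'1 absz_gt0.
    by apply: contra_neq m0 => m'0; rewrite mE m'0 mul0r.
  by rewrite mE nE dvdz_mul.
by move=> h; apply: dvdz_trans (key h 0%N); rewrite dvdz_mull.
Qed.

(** * Evaluation of words *)

Section EvalWord.
Context (G : groupType) (k : nat) (s : 'I_k -> G).
Local Open Scope group_scope.

Lemma eval_word_nil : eval_word s [::] = 1.
Proof. by rewrite /eval_word big_nil. Qed.

Lemma eval_word_cons x w : eval_word s (x :: w) = eval_letter s x * eval_word s w.
Proof. by rewrite /eval_word big_cons. Qed.

Lemma eval_word_cat u v : eval_word s (u ++ v) = eval_word s u * eval_word s v.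
Proof. by rewrite /eval_word big_cat. Qed.

Lemma eval_letter_inv x : eval_letter s (letter_inv x) = (eval_letter s x)^-1.
Proof. by case: x => i [] //; rewrite /eval_letter /= invgK. Qed.

Lemma eval_word_inv w : eval_word s (word_inv w) = (eval_word s w)^-1.
Proof.
elim: w => [|x w IH]; first by rewrite /word_inv eval_word_nil invg1.
have -> : word_inv (x :: w) = word_inv w ++ [:: letter_inv x].
  by rewrite /word_inv /= rev_cons cats1.
rewrite eval_word_cat !eval_word_cons eval_word_nil mulg1 IH eval_letter_inv.
by rewrite invgM.
Qed.

Lemma pres_eq_eval (rel : set (word k)) u v :
  (forall r, rel r -> eval_word s r = 1) ->
  pres_eq rel u v -> eval_word s u = eval_word s v.
Proof.
move=> relG; elim=> {u v} //.
- by move=> u v w _ -> _ ->.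
- by move=> u u' v v' _ uu' _ vv'; rewrite !eval_word_cat uu' vv'.
- move=> x; rewrite !eval_word_cons eval_word_nil mulg1 eval_letter_inv.
  by rewrite mulgV.
- by move=> r /relG ->; rewrite eval_word_nil.
Qed.

(** The letter in [gen_pow] changes with the sign of the exponent, so the steps by [1] and [-1] are
    settled first; induction on [y] does the rest. *)
Lemma eval_gen_powD i (x y : int) :
  eval_word s (gen_pow i (x + y)%R) =
  eval_word s (gen_pow i x) * eval_word s (gen_pow i y).
Proof.
have eP (n : nat) : eval_word s (gen_pow i n%:Z) = s i ^+ n.
  rewrite /gen_pow /=; elim: n => [|n IH]; first exact: eval_word_nil.
  by rewrite /= eval_word_cons IH expgS.
have eN (n : nat) : eval_word s (gen_pow i (- n%:Z)%R) = (s i)^-1 ^+ n.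
  case: n => [|n]; first by rewrite oppr0 eP.
  rewrite /gen_pow abszN oppr_lt0 ltz_nat ltn0Sn absz_nat.
  elim: n.+1 => [|l IH]; first exact: eval_word_nil.
  by rewrite /= eval_word_cons IH expgS.
have succ z : eval_word s (gen_pow i (z + 1)%R) = eval_word s (gen_pow i z) * s i.
  case: (intP z) => [|p|p].
  - by rewrite add0r (eP 1%N) (eP 0%N) mul1g.
  - by rewrite -PoszD addn1 !eP expgSr.
  - have -> : (- p.+1%:Z + 1 = - p%:Z)%R by lia.
    by rewrite !eN expgSr mulgVK.
have pred z : eval_word s (gen_pow i (z - 1)%R) = eval_word s (gen_pow i z) * (s i)^-1.
  by rewrite -{2}(subrK 1%R z) succ mulgK.
elim/int_ind: y => [|n IH|n IH].
- by rewrite addr0 (eP 0%N) mulg1.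
- have -> : (n.+1%:Z = n%:Z + 1)%R by lia.
  by rewrite addrA !succ IH mulgA.
- have -> : (- n.+1%:Z = - n%:Z - 1)%R by lia.
  by rewrite addrA !pred IH mulgA.
Qed.

End EvalWord.

(** * Finite presentations and limits of marked groups *)

Definition subst_word k l (v : 'I_k -> word l) (w : word k) : word l :=
  flatten [seq if x.2 then word_inv (v x.1) else v x.1 | x <- w].

Lemma eval_subst_word (G : groupType) k l (s : 'I_l -> G) (v : 'I_k -> word l) w :
  eval_word s (subst_word v w) = eval_word (fun i => eval_word s (v i)) w.
Proof.
elim: w => [|x w IH]; first by rewrite !eval_word_nil.
rewrite eval_word_cons -IH [LHS]eval_word_cat; congr (_ * _)%g.
by case: x => i [] //=; rewrite eval_word_inv.
Qed.

(* [{multiplicative G -> H}] only provides compatibility with products. *)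
Lemma multiplicative1 (G H : groupType) (f : {multiplicative G -> H}) :
  f 1%g = 1%g.
Proof. by apply: (@mulgI _ (f 1%g)); rewrite -gmulfM !mulg1. Qed.

Lemma multiplicativeV (G H : groupType) (f : {multiplicative G -> H}) x :
  f x^-1%g = (f x)^-1%g.
Proof.
by apply: (@mulgI _ (f x)); rewrite -gmulfM !mulgV multiplicative1.
Qed.

Lemma eval_word_morph (G H : groupType) (f : {multiplicative G -> H}) k
    (s : 'I_k -> G) w : f (eval_word s w) = eval_word (f \o s) w.
Proof.
elim: w => [|x w IH]; first by rewrite !eval_word_nil multiplicative1.
rewrite !eval_word_cons gmulfM IH; congr (_ * _)%g.
by case: x => i [] //; rewrite /eval_letter /= multiplicativeV.
Qed.

(* [F] consists of the relators and of the expressions of the marking in terms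
   of the generators of the presentation, all rewritten in the marking. *)
Lemma finitely_presented_marking k (L : marked_group k) :
  finitely_presented L ->
  exists F : seq (word k), all (trivial_in L) F /\
    forall G : marked_group k, all (trivial_in G) F ->
    forall w, trivial_in L w -> trivial_in G w.
Proof.
move=> [l [rels [f fbij]]].
have [v vE] := choice (fun j : 'I_l => marking_generates (f (pres_gen _ j))).
have [g fK gK] := fbij.
have [p pE] := choice (fun i : 'I_k => @pres_gen_generates _ _ (g (marking L i))).
have fpE w : f (eval_word (@pres_gen _ _) w) = eval_word (marking L) (subst_word v w).
  rewrite eval_word_morph eval_subst_word; congr eval_word.
  by apply/funext => j /=; rewrite vE.
exists ([seq subst_word v r | r <- rels] ++
  [seq (i, true) :: subst_word v (p i) | i <- enum 'I_k]); split.
  rewrite all_cat !all_map; apply/andP; split.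
    apply/allP => r rr /=; rewrite /trivial_in -fpE eval_pres_gen.
    have -> : pres_class [set r | r \in rels]%classic r = 1%g.
      by apply/pres_classP; apply: pres_rel.
    by rewrite multiplicative1.
  apply/allP => i _ /=; rewrite /trivial_in eval_word_cons -fpE pE gK.
  by rewrite /eval_letter /= mulVg.
move=> G; rewrite all_cat !all_map => /andP[/allP relG /allP genG] w wL.
(* The second family in [F] says that, in [G], each marked generator equals its expression through
   the presentation. *)
have -> : trivial_in G w = trivial_in G (subst_word v (subst_word p w)).
  rewrite /trivial_in !eval_subst_word; congr (_ == _); congr eval_word.
  apply/funext => i; have := genG i; rewrite -enumT mem_enum => /(_ isT) /eqP.
  by rewrite eval_word_cons eval_subst_word /eval_letter /= => /mulg1_eq; rewrite invgK.
(* Injectivity of [f] makes the rewritten [w] a consequence of the relators, and these hold in [G]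
   by the first family in [F]. *)
have pw : pres_eq [set r | r \in rels]%classic (subst_word p w) [::].
  apply/pres_classP; rewrite -eval_pres_gen eval_subst_word.
  apply: (bij_inj fbij); rewrite [RHS]multiplicative1 eval_word_morph -(eqP wL).
  by congr eval_word; apply/funext => i /=; rewrite pE gK.
rewrite /trivial_in eval_subst_word.
rewrite (pres_eq_eval _ pw) ?eval_word_nil// => r rr.
by have /eqP := relG _ rr; rewrite eval_subst_word.
Qed.

(** At distance less than [expR (- size w)], no word as short as [w] can distinguish the two
    groups. *)
Lemma marked_cvg_trivial_in (R : realType) k (G : nat -> marked_group k)
    (L : marked_group k) (w : word k) : marked_cvg R G L ->
  (\forall n \near \oo, trivial_in (G n) w = trivial_in L w)%classic.
Proof.
move=> GL.
have : (\forall n \near \oo,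
    marked_dist R (G n) L < expR (- (size w)%:R))%classic.
  by apply: (cvgr_lt _ GL); exact: expR_gt0.
apply: filterS => n; rewrite /marked_dist; case: pselect => [e|ne] lt_dist.
  case: ex_minnP lt_dist => i _ imin.
  rewrite ltr_expR ltrN2 ltr_nat => ltwi.
  apply: contrapT => /eqP neq.
  have := imin (size w); rewrite leqNgt ltwi => /(_ _)/notF; apply.
  by apply/existsP; exists (in_tuple w).
apply: contrapT => /eqP neq; apply: ne; exists (size w).
by apply/existsP; exists (in_tuple w).
Qed.

(** * An action of [BS(m, n)] *)

(* [BS(m, n)] acts on [int * nat], [b] adding [1] to the first component and [a]
   acting as [BS_shift m n].  Number by [t * |m| + i] the orbit of [b^m] through
   [(i, t)], where [0 <= i < |m|], and similarly for [b^n]: [a] maps each orbit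
   of [b^m] equivariantly onto the orbit of [b^n] with the same number. *)
Definition BS_shift (m n : int) (p : int * nat) : int * nat :=
  let x := (p.2 * `|m| + `|(p.1 %% m)%Z|)%N in
  (n * (p.1 %/ m)%Z + (x %% `|n|)%N%:Z, (x %/ `|n|)%N).

Lemma BS_shiftE (m n q : int) (i t : nat) : (i < `|m|)%N ->
  BS_shift m n (m * q + i%:Z, t) =
  (n * q + ((t * `|m| + i) %% `|n|)%N%:Z, ((t * `|m| + i) %/ `|n|)%N).
Proof.
move=> im; have m0 : m != 0 by lia.
rewrite /BS_shift /= [m * q]mulrC divzMDl// modzMDl divz_small; last by lia.
by rewrite addr0 -modz_abs modz_nat absz_nat (modn_small im).
Qed.

Lemma divz_nat_eq (m y : int) : m != 0 ->
  exists q (i : nat), (i < `|m|)%N /\ y = m * q + i%:Z.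
Proof.
move=> m0; exists (y %/ m)%Z, `|(y %% m)%Z|%N.
rewrite -ltz_nat gez0_abs ?modz_ge0// ltz_mod//; split=> //.
by rewrite mulrC -divz_eq.
Qed.

(** The numberings of the two families of orbits play symmetric roles, so exchanging [m] and [n]
    inverts the map. *)
Lemma BS_shiftK (m n : int) : m != 0 -> n != 0 ->
  cancel (BS_shift m n) (BS_shift n m).
Proof.
move=> m0 n0 [y t]; have [q [i [im ->]]] := divz_nat_eq y m0.
rewrite (BS_shiftE _ _ _ im) BS_shiftE; last by rewrite ltn_mod absz_gt0.
by rewrite -divn_eq modnMDl modn_small// divnMDl ?divn_small ?addn0//; lia.
Qed.

Lemma BS_shiftD (m n z y : int) (t : nat) : m != 0 ->
  BS_shift m n (y + m * z, t) =
  ((BS_shift m n (y, t)).1 + n * z, (BS_shift m n (y, t)).2).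
Proof.
move=> m0; have [q [i [im ->]]] := divz_nat_eq y m0.
by rewrite addrAC -mulrDr !(BS_shiftE _ _ _ im) mulrDr addrAC.
Qed.

Definition shift_fst (k : int) (p : int * nat) : int * nat := (p.1 + k, p.2).

Definition BS_act_letter (m n : int) (x : letter 2) (p : int * nat) :
    int * nat :=
  if x.1 == gen_a then
    if x.2 then BS_shift n m p else BS_shift m n p
  else shift_fst (if x.2 then -1 else 1) p.

Definition BS_act (m n : int) (w : word 2) (p : int * nat) : int * nat :=
  foldr (BS_act_letter m n) p w.

Lemma BS_act_cat m n u v p :
  BS_act m n (u ++ v) p = BS_act m n u (BS_act m n v p).
Proof. by rewrite /BS_act foldr_cat. Qed.

Lemma BS_act_gen_b m n z p :
  BS_act m n (gen_pow gen_b z) p = shift_fst z p.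
Proof.
have step l b q : BS_act m n (nseq l (gen_b, b)) q =
    shift_fst (if b then - l%:Z else l%:Z) q.
  elim: l => [|l IH]; first by rewrite /shift_fst; case: b; rewrite ?oppr0 addr0; case: q.
  rewrite /= IH /BS_act_letter /shift_fst /=; congr (_, _); case: b {IH} => /=; lia.
by rewrite /gen_pow step; congr shift_fst; case: ifP; lia.
Qed.

Lemma BS_act_gen_a m n p : BS_act m n (gen_pow gen_a 1) p = BS_shift m n p.
Proof. by []. Qed.

Lemma BS_act_gen_aV m n p :
  BS_act m n (gen_pow gen_a (-1)) p = BS_shift n m p.
Proof. by []. Qed.

Lemma pres_eq_BS_act (m n : int) u v : m != 0 -> n != 0 ->
  pres_eq [set BS_relator m n]%classic u v -> BS_act m n u =1 BS_act m n v.
Proof.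
move=> m0 n0; elim=> {u v} //.
- by move=> u v _ uv p; rewrite uv.
- by move=> u v w _ uv _ vw p; rewrite uv.
- by move=> u u' v v' _ uu' _ vv' p; rewrite !BS_act_cat uu' vv'.
- case=> i b p; rewrite /BS_act /= /BS_act_letter /letter_inv /=.
  case: eqP => _; first by case: b; rewrite /= BS_shiftK.
  by case: p => z t; congr (_, _); case: b => /=; ring.
- move=> _ -> [y t]; rewrite /BS_relator !BS_act_cat !BS_act_gen_b.
  rewrite BS_act_gen_aV BS_act_gen_a.
  rewrite {2}/shift_fst /=.
  case E : (BS_shift n m _) => [y' t'].
  have e := BS_shiftD n 1 y' t' m0; rewrite !mulr1 in e.
  by rewrite [LHS]e -E BS_shiftK//= subrK.
Qed.

(** The two sides are the actions of [a b^k a^-1 b] and [b a b^k a^-1]. If [m] does not divide [k],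
    adding [k] sends some two neighbours in [[0, |m|)] to different blocks of length [|m|]. The
    images of these blocks under [a] start [|n|] apart, so the points can remain neighbours only if
    [|n| = |m|]. *)
Lemma BS_shift_commute (m n k : int) : m != 0 -> (`|m| < `|n|)%N ->
  (forall p,
    BS_shift m n (shift_fst k (BS_shift n m (shift_fst 1 p))) =
    shift_fst 1 (BS_shift m n (shift_fst k (BS_shift n m p)))) ->
  (m %| k)%Z.
Proof.
move=> m0 mn comm; apply/dvdz_mod0P/eqP/negPn/negP => k0.
have [q [l [lm kE]]] := divz_nat_eq k m0.
have l0 : (0 < l)%N.
  by rewrite lt0n; apply: contra_neq k0 => l0; rewrite kE l0 addr0 mulrC modzMl.
have base (i : nat) : (i < `|m|)%N -> BS_shift n m (i%:Z, 0%N) = (i%:Z, 0%N).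
  move=> im; rewrite -[i%:Z]add0r -{1}(mulr0 n) BS_shiftE ?(ltn_trans im)//.
  by rewrite mul0n add0n modn_small// divn_small// mulr0.
(* Write [k = m * q + l]: adding [k] moves [|m| - l - 1] to the last point of a
   block [m * q + [0, |m|)] and its successor to the next block. *)
have addE z y t : shift_fst z (y, t) = (y + z, t) by [].
have := comm ((`|m| - l.+1)%N%:Z, 0%N); rewrite addE.
have -> : (`|m| - l.+1)%N%:Z + 1 = (`|m| - l)%N%:Z by lia.
rewrite !base; try lia.
rewrite ![shift_fst k _]addE kE.
have -> : (`|m| - l.+1)%N%:Z + (m * q + l%:Z) = m * q + (`|m|.-1)%N%:Z by lia.
have -> : (`|m| - l)%N%:Z + (m * q + l%:Z) = m * (q + Num.sg m) + 0%N%:Z.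
  by rewrite mulrDr; case: sgrP m0 => // m0 _; lia.
rewrite !BS_shiftE; try lia.
rewrite !mul0n !add0n mod0n addE modn_small; last by lia.
move=> [e _]; have : `|(n * Num.sg m)%R|%N = `|m|%N by rewrite mulrDr in e; lia.
by rewrite abszM absz_sg m0 muln1 => nm; rewrite nm ltnn in mn.
Qed.

(** * The words [w_i] in [BS(m, n)] *)

Lemma int_morph_eq (G : groupType) (f g : int -> G) :
  (forall x y, f (x + y) = (f x * f y)%g) ->
  (forall x y, g (x + y) = (g x * g y)%g) -> f 1 = g 1 -> f =1 g.
Proof.
move=> fD gD fg1.
have fg0 : f 0 = g 0.
  have h0 (h : int -> G) : (forall x y, h (x + y) = (h x * h y)%g) -> h 0 = 1%g.
    by move=> hD; apply: (@mulgI _ (h 0)); rewrite -hD addr0 mulg1.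
  by rewrite !h0.
elim/int_ind=> [//|n IH|n IH].
  by rewrite -addn1 PoszD fD gD IH fg1.
apply: (@mulIg _ (f 1)); rewrite {2}fg1 -fD -gD.
by have -> : - n.+1%:Z + 1 = - n%:Z by lia.
Qed.

Lemma eval_gen_powN (G : groupType) k (s : 'I_k -> G) i (z : int) :
  eval_word s (gen_pow i (- z)) = (eval_word s (gen_pow i z))^-1%g.
Proof.
apply: (@mulgI _ (eval_word s (gen_pow i z))).
by rewrite -eval_gen_powD subrr mulgV; exact: eval_word_nil.
Qed.

(** Both sides are homomorphisms in [q], and the relator is the case [q = 1]. *)
Lemma eval_BS_relator_conj (G : groupType) (s : 'I_2 -> G) (m n q : int) :
  eval_word s (BS_relator m n) = 1%g ->
  eval_word s (gen_pow gen_a 1 ++ gen_pow gen_b (m * q) ++ gen_pow gen_a (-1)) =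
  eval_word s (gen_pow gen_b (n * q)).
Proof.
move=> rel1; move: q; apply: int_morph_eq => [x y|x y|].
- rewrite mulrDr !eval_word_cat !eval_gen_powD eval_gen_powN.
  by rewrite !mulgA mulgVK.
- by rewrite mulrDr eval_gen_powD.
- rewrite !mulr1; move: rel1; rewrite /BS_relator !catA eval_word_cat.
  by rewrite eval_gen_powN => /divg1_eq.
Qed.

(* The words [w_i] of the header. *)
Fixpoint BS_conj (m : int) (r : nat -> int) (i : nat) : word 2 :=
  if i is j.+1 then
    gen_pow gen_a 1 ++ (gen_pow gen_b (- r j) ++ BS_conj m r j) ++
      gen_pow gen_a (-1)
  else gen_pow gen_a 1 ++ gen_pow gen_b m ++ gen_pow gen_a (-1).

Lemma eval_BS_conj (G : groupType) (s : 'I_2 -> G) (m n : int) r i :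
  eval_word s (BS_relator m n) = 1%g ->
  (forall j, (j < i)%N -> r j = (BS_exp m n j %% m)%Z) ->
  eval_word s (BS_conj m r i) = eval_word s (gen_pow gen_b (BS_exp m n i)).
Proof.
move=> rel1; elim: i => [|i IH] rE.
  by have := eval_BS_relator_conj 1 rel1; rewrite !mulr1.
rewrite [BS_conj _ _ _]/BS_conj -/(BS_conj m r i) eval_word_cat [in X in (_ * X)%g]eval_word_cat.
rewrite [in X in (_ * (X * _))%g]eval_word_cat IH => [|j ji]; last first.
  by rewrite rE// ltnW.
rewrite -eval_gen_powD.
have -> : - r i + BS_exp m n i = m * (BS_exp m n i %/ m)%Z.
  by rewrite [X in _ + X](divz_eq _ m) rE// addrC addrK mulrC.
by rewrite -!eval_word_cat (eval_BS_relator_conj _ rel1).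
Qed.

Definition comm_b (w : word 2) : word 2 :=
  (gen_pow gen_b 1 ++ w) ++ word_inv (w ++ gen_pow gen_b 1).

Lemma trivial_in_comm_b (G : marked_group 2) w :
  trivial_in G (comm_b w) =
  (eval_word (marking G) (gen_pow gen_b 1 ++ w) ==
   eval_word (marking G) (w ++ gen_pow gen_b 1)).
Proof. by rewrite /trivial_in /comm_b eval_word_cat eval_word_inv divg_eq1. Qed.

Lemma eval_BS_relator (m n : int) :
  eval_word (marking (BS m n)) (BS_relator m n) = 1%g.
Proof. by rewrite eval_pres_gen; apply/pres_classP; exact: pres_rel. Qed.

Lemma trivial_in_comm_b_act (m n : int) w : m != 0 -> n != 0 ->
  trivial_in (BS m n) (comm_b w) ->
  forall p, shift_fst 1 (BS_act m n w p) = BS_act m n w (shift_fst 1 p).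
Proof.
move=> m0 n0; rewrite trivial_in_comm_b !eval_pres_gen => /eqP/pres_classP.
move=> /(pres_eq_BS_act m0 n0) e p.
by have := e p; rewrite !BS_act_cat !BS_act_gen_b.
Qed.

Lemma BS_shift_conj (m n z : int) p : m != 0 -> n != 0 ->
  BS_shift m n (shift_fst (m * z) (BS_shift n m p)) = shift_fst (n * z) p.
Proof.
move=> m0 n0; rewrite -[in RHS](BS_shiftK n0 m0 p).
by case: (BS_shift n m p) => y t; rewrite [LHS]BS_shiftD.
Qed.

Lemma shift_fstD x y p : shift_fst x (shift_fst y p) = shift_fst (x + y) p.
Proof. by rewrite /shift_fst /= -addrA [y + x]addrC. Qed.

(** If [w_i] acts as [b^(e_i)], then [w_(i+1)] acts as [a b^(e_i - r_i) a^-1]. Commuting with [b]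
    forces [m] to divide [e_i - r_i], whence [w_(i+1)] acts as [b^(e_(i+1))] and the induction
    continues. *)
Lemma BS_conj_comm_mod (m n : int) r : m != 0 -> (`|m| < `|n|)%N ->
  (forall i, r i = (r i %% m)%Z) ->
  (forall i, trivial_in (BS m n) (comm_b (BS_conj m r i))) ->
  forall i, r i = (BS_exp m n i %% m)%Z.
Proof.
move=> m0 mn rm wb; have n0 : n != 0 by lia.
have step i : BS_act m n (BS_conj m r i) =1 shift_fst (BS_exp m n i) ->
    BS_act m n (BS_conj m r i.+1) =1 (fun p =>
      BS_shift m n (shift_fst (BS_exp m n i - r i) (BS_shift n m p))) /\
    (m %| BS_exp m n i - r i)%Z.
  move=> IH.
  have e : BS_act m n (BS_conj m r i.+1) =1 (fun p =>
      BS_shift m n (shift_fst (BS_exp m n i - r i) (BS_shift n m p))).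
    move=> p; rewrite !BS_act_cat BS_act_gen_a BS_act_gen_aV IH BS_act_gen_b.
    by rewrite shift_fstD addrC.
  split=> //; apply: (BS_shift_commute m0 mn) => p.
  by rewrite -!e -trivial_in_comm_b_act.
have act i : BS_act m n (BS_conj m r i) =1 shift_fst (BS_exp m n i).
  elim: i => [|i IH] p.
    rewrite !BS_act_cat BS_act_gen_a BS_act_gen_aV BS_act_gen_b.
    by have := BS_shift_conj 1 p m0 n0; rewrite !mulr1.
  have [-> /dvdzP[q qE]] := step i IH.
  rewrite qE mulrC BS_shift_conj//=.
  have -> : BS_exp m n i = q * m + r i by rewrite -qE subrK.
  by rewrite divzMDl// rm divz_small ?addr0// modz_ge0// ltz_mod.
move=> i; have [_] := step i (act i); rewrite -eqz_mod_dvd => /eqP ->.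
exact: rm.
Qed.

(** * Residues of [m]-adic integers and the limit group *)

Lemma madic_red_res (m : int) (x : madic m) h :
  madic_red m h (madic_res x h) = madic_res x h.
Proof. by rewrite madic_coherent /madic_red modz_mod. Qed.

Lemma madic_eq (m : int) (x y : madic m) :
  (forall h, madic_res x h = madic_res y h) -> x = y.
Proof.
case: x y => [f fc] [g gc] /= /funext fg; move: fc gc; rewrite fg => fc gc.
by congr Madic; exact: Prop_irrelevance.
Qed.

Lemma madic_dvd_res1 (m : int) (x : madic m) : m != 0 ->
  madic_res x 1 = 0 -> madic_dvd x.
Proof.
move=> m0 x0.
(* The residue at level [h + 1] is used because division by [m] loses one power of [m]. *)
pose y h := madic_red m h (madic_res x h.+1 %/ m)%Z.
have yc h : y h = madic_red m h (y h.+1).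
  rewrite /y madic_red_redS; apply: (modz_expS_divz m0).
  by rewrite [in LHS]madic_coherent /madic_red modz_mod.
have mx h : (m %| madic_res x h.+1)%Z.
  elim: h => [|h IH]; first by rewrite x0 dvdz0.
  rewrite (divz_eq (madic_res x h.+2) (m ^+ h.+1)) rpredD//.
    by rewrite exprS dvdz_mull// dvdz_mulr.
  by move: IH; rewrite madic_coherent.
exists (Madic yc); apply: madic_eq => h /=.
by rewrite /y /madic_red modzMmr mulrC divzK// madic_coherent.
Qed.

Theorem theorem5 (R : realType) (m : int) (hm : m <> 0%R) (xi : madic m)
  (hxi : ~ madic_dvd xi) (L : marked_group 2) (hL : is_BSbar R xi L) :
  ~ finitely_presented L.
Proof.
move=> /finitely_presented_marking[F [FL FG]].
have [u [_ u_oo u_xi u_L]] := hL.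
have m0 : m != 0 by apply/eqP.
pose r i := (BS_exp m (madic_res xi i.+1) i %% m)%Z.
have rE i : (\forall N \near \oo, r i = (BS_exp m (u N) i %% m)%Z)%classic.
  apply: filterS (u_xi i.+1) => N uN.
  have /(BS_exp_mod m0) : (madic_res xi i.+1 = u N %[mod m ^+ (1 + i)])%Z.
    by rewrite add1n; exact: etrans (madic_red_res _ _) (esym uN).
  by [].
have rE_lt i : (\forall N \near \oo,
    forall j, (j < i)%N -> r j = (BS_exp m (u N) j %% m)%Z)%classic.
  elim: i => [|i IH]; first by apply: nearW.
  apply: filterS2 IH (rE i) => N rN riN j; rewrite ltnS leq_eqVlt.
  by move=> /predU1P[->//|]; exact: rN.
have commL i : trivial_in L (comm_b (BS_conj m r i)).
  have [|N [rN <-]] := @filter_ex _ \oo%classic _ (fun N =>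
      (forall j, (j < i)%N -> r j = (BS_exp m (u N) j %% m)%Z) /\
      trivial_in (BS m (u N)) (comm_b (BS_conj m r i)) =
      trivial_in L (comm_b (BS_conj m r i))).
    by apply: filterI; [exact: rE_lt|exact: (marked_cvg_trivial_in _ u_L)].
  rewrite trivial_in_comm_b !eval_word_cat.
  rewrite (eval_BS_conj (eval_BS_relator _ _) rN).
  by rewrite -!eval_gen_powD addrC.
have FN : (\forall N \near \oo, all (trivial_in (BS m (u N))) F)%classic.
  elim: F FL {FG} => [|w F IH] /=; first by move=> _; apply: nearW.
  move=> /andP[wL /IH FN].
  apply: filterS2 FN (marked_cvg_trivial_in w u_L) => N -> ->.
  by rewrite wL.
(* Eventually [u_N mod m] is the first residue of [xi], which is non-zero because [m] does not
   divide [xi]. *)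
have good : (\forall N \near \oo, [/\ all (trivial_in (BS m (u N))) F,
    (`|m| < `|u N|)%N & ~~ (m %| u N)%Z])%classic.
  apply: filterS3 FN (u_oo `|m|.+1) (u_xi 1%N) => N ? ? uN; split=> //.
  apply/negP => /dvdz_mod0P mu; apply: hxi; apply: madic_dvd_res1 => //.
  by rewrite -uN.
have modE N : [/\ all (trivial_in (BS m (u N))) F,
    (`|m| < `|u N|)%N & ~~ (m %| u N)%Z] ->
    forall i, (BS_exp m (u N) i %% m)%Z = r i.
  move=> [FuN muN _] i; symmetry; apply: BS_conj_comm_mod => // j.
    by rewrite /r modz_mod.
  exact: (FG _ FuN).
(* Two good indices with [|u_N| > |u_N0|] share all residues [r_i], which forces [u_N = u_N0], a
   contradiction. *)
have [N0 good0] := filter_ex good.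
have [N [goodN]] := filter_ex (filterI good (u_oo `|u N0|.+1)).
suff -> : u N = u N0 by rewrite ltnn.
by apply: (BS_exp_mod_inj m0) => [|i]; [case: goodN|rewrite !modE].
Qed.
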